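(* Let $(c_n)_{n\ge 0}$ be the unique sequence of rational numbers satisfying, for all $n\ge 0$, $$4(n+4)c_{n+5}+8(n+2)c_{n+4}+(n+3)c_{n+3}+(4n+7)c_{n+2}+(5n+4)c_{n+1}+2n\,c_n=0,$$ with initial values $c_0=0,\ c_1=1,\ c_2=2,\ c_3=-\tfrac18,\ c_4=-\tfrac12$. Then: (a) the sequence $(c_n)$ does not satisfy any linear recurrence with constant coefficients; (b) each $c_n$ is a rational number whose denominator is a power of $2$; (c) for every odd prime $p$ and all integers $k,r\ge 0$, $$c_{kp^{r+1}}\equiv c_{kp^r}\pmod{p^{r+1}}.$$
   Context: The congruence in (c) is between rational numbers whose denominators are prime to $p$ (by (b)), i.e. it is meant in the localization $\mathbb{Z}_{(p)}$ (equivalently in $\mathbb{Z}_p$). *)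

(* Defs.v *)
From mathcomp Require Import all_boot all_order all_algebra.

Set Implicit Arguments.
Unset Strict Implicit.
Unset Printing Implicit Defensive.

Import Order.TTheory GRing.Theory Num.Theory.
Local Open Scope ring_scope.

Definition is_sequence_c (c : nat -> rat) : Prop :=
  [/\ c 0%N = 0, c 1%N = 1, c 2%N = 2, c 3%N = - (1 / 8) & c 4%N = - (1 / 2)]
  /\ forall n : nat,
       4 * (n + 4)%:R * c (n + 5)%N
     + 8 * (n + 2)%:R * c (n + 4)%N
     + (n + 3)%:R * c (n + 3)%N
     + (4 * n + 7)%:R * c (n + 2)%N
     + (5 * n + 4)%:R * c (n + 1)%N
     + 2 * n%:R * c n = 0.

(* Homogeneous recurrence of some order d. The a i, including a 0, may vanish,
   so a recurrence valid only from some index on is covered as well (with a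
   larger d). *)
Definition has_constant_recurrence (F : fieldType) (u : nat -> F) : Prop :=
  exists (d : nat) (a : 'I_d -> F),
    forall n : nat, u (n + d)%N = \sum_(i < d) a i * u (n + i)%N.

(* Membership in the localization Z_(p), for p prime. *)
Definition Zloc (p : nat) : pred rat := fun x => ~~ (p %| `|denq x|)%N.

(* x = y mod m Z_(p), for elements x and y of Z_(p). *)
Definition congr_Zloc (p m : nat) (x y : rat) : Prop :=
  [/\ Zloc p x, Zloc p y & exists2 z : rat, Zloc p z & x - y = m%:R * z].

(* Main.v *)
(* With u = x + x^2, the recurrence says that f = sum c_n x^n satisfies a
   first-order linear differential equation, whose solution is
     f = x u' / sqrt (1 + u^2 / 4) = x d/dx (2 arsinh (u / 2)).
   Expanding in powers of u gives
     c_n = sum_(1 <= j <= n) a_j (n / j) C(j, n - j),   a_j = 2 C(j/2, j).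
   For p odd, 1/2 is a p-adic limit of integers, so the congruence
   C(pN, pK) = C(N, K) mod p^(v(N) + 1) yields a_(pi) = a_i mod p^(v(i) + 1);
   comparing the terms j = pi of c_(pm) with the terms i of c_m, and noting that
   the terms of c_(pm) with p not dividing j are divisible by p m, gives (c),
   while the p-integrality of every c_n for every odd p gives (b).
   A recurrence with constant coefficients would make f rational, hence
   4 + u^2 a square of a rational function; but 4 + u^2 is squarefree. *)
Require Import Defs.
From mathcomp Require Import all_boot all_order all_algebra.
From mathcomp Require Import ring lra zify.

Set Implicit Arguments.
Unset Strict Implicit.
Unset Printing Implicit Defensive.

Import Order.TTheory GRing.Theory Num.Theory.
Local Open Scope ring_scope.

(** * The ideals of the localization at [p] *)

(* Membership in p^e Z_(p). *)
Definition Zloc_ideal (p e : nat) (x : rat) : Prop :=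
  exists (b : nat) (z : int),
    ~~ (p %| b)%N /\ x * b%:R = (p ^ e)%N%:R * z%:~R.

Lemma Zloc_ideal_int p (z : int) : prime p -> Zloc_ideal p 0 z%:~R.
Proof.
move=> pp; exists 1%N, z; rewrite dvdn1 expn0 mulr1 mul1r; split=> //.
by rewrite neq_ltn prime_gt1 // orbT.
Qed.

Lemma Zloc_ideal_nat p n : prime p -> Zloc_ideal p 0 n%:R.
Proof. exact: (@Zloc_ideal_int p n%:Z). Qed.

Lemma Zloc_ideal_half p : prime p -> odd p -> Zloc_ideal p 0 (1 / 2).
Proof.
move=> pp op; exists 2%N, 1; rewrite expn0 divfK //; split=> //.
by rewrite dvdn_prime2 //; apply: contraTneq op => ->.
Qed.

Lemma Zloc_ideal_dvd p e n : prime p -> (p ^ e %| n)%N -> Zloc_ideal p e n%:R.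
Proof.
move=> pp /dvdnP[k ->]; exists 1%N, k%:Z; rewrite dvdn1 mulr1 natrM mulrC.
by split=> //; rewrite neq_ltn prime_gt1 // orbT.
Qed.

Lemma Zloc_idealD p e x y : prime p ->
  Zloc_ideal p e x -> Zloc_ideal p e y -> Zloc_ideal p e (x + y).
Proof.
move=> pp [b [z [pb xb]]] [b' [z' [pb' yb]]].
exists (b * b')%N, (z * b'%:Z + z' * b%:Z); rewrite Euclid_dvdM // negb_or pb pb'.
split=> //; rewrite natrM mulrDl mulrA xb mulrCA yb rmorphD !rmorphM /=.
by rewrite -!pmulrn; ring.
Qed.

Lemma Zloc_idealM p e e' x y : prime p ->
  Zloc_ideal p e x -> Zloc_ideal p e' y -> Zloc_ideal p (e + e') (x * y).
Proof.
move=> pp [b [z [pb xb]]] [b' [z' [pb' yb]]].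
exists (b * b')%N, (z * z'); rewrite Euclid_dvdM // negb_or pb pb'.
by split=> //; rewrite expnD !natrM mulrACA xb yb rmorphM /= mulrACA.
Qed.

Lemma Zloc_idealMl p e x y : prime p ->
  Zloc_ideal p 0 x -> Zloc_ideal p e y -> Zloc_ideal p e (x * y).
Proof. exact: Zloc_idealM. Qed.

Lemma Zloc_idealMr p e x y : prime p ->
  Zloc_ideal p e x -> Zloc_ideal p 0 y -> Zloc_ideal p e (x * y).
Proof. by move=> pp Ix Iy; rewrite mulrC; apply: Zloc_idealMl. Qed.

Lemma Zloc_idealN p e x : Zloc_ideal p e x -> Zloc_ideal p e (- x).
Proof.
by move=> [b [z [pb xb]]]; exists b, (- z); rewrite mulNr xb rmorphN mulrN.
Qed.

Lemma Zloc_idealB p e x y : prime p ->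
  Zloc_ideal p e x -> Zloc_ideal p e y -> Zloc_ideal p e (x - y).
Proof. by move=> pp Ix Iy; apply/Zloc_idealD/Zloc_idealN. Qed.

Lemma Zloc_ideal0 p e : prime p -> Zloc_ideal p e 0.
Proof. by move=> pp; apply: (@Zloc_ideal_dvd p e 0). Qed.

Lemma Zloc_ideal_sum p e (I : Type) (r : seq I) (P : pred I) (F : I -> rat) :
  prime p -> (forall i, P i -> Zloc_ideal p e (F i)) ->
  Zloc_ideal p e (\sum_(i <- r | P i) F i).
Proof.
move=> pp IF; elim/big_ind: _ => //; first exact: Zloc_ideal0.
by move=> x y; apply: Zloc_idealD.
Qed.

Lemma Zloc_ideal_le p e e' x : (e' <= e)%N ->
  Zloc_ideal p e x -> Zloc_ideal p e' x.
Proof.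
move=> le [b [z [pb xb]]]; exists b, ((p ^ (e - e'))%N%:Z * z).
split=> //; rewrite xb -{1}(subnKC le) expnD natrM rmorphM /= mulrA.
by rewrite -pmulrn.
Qed.

(** Dividing by [j] costs exactly [logn p j] powers of [p]: the part of [j] prime to [p] is absorbed
    into the denominator. *)
Lemma Zloc_ideal_div p e j x : prime p -> (0 < j)%N ->
  Zloc_ideal p (e + logn p j) (x * j%:R) -> Zloc_ideal p e x.
Proof.
move=> pp j0 [b [z [pb xb]]]; exists (j`_p^' * b)%N, z.
rewrite Euclid_dvdM // negb_or pb andbT; split.
  rewrite -prime_coprime //.
  have := part_pnat p^' j; rewrite p'natE // => h.
  by rewrite prime_coprime.
have p0 : (p ^ logn p j)%N%:R != 0 :> rat
  by rewrite pnatr_eq0 expn_eq0; case: p pp {xb pb}.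
apply: (mulfI p0); rewrite [RHS]mulrA -natrM -expnD [(logn p j + e)%N]addnC -xb.
have -> : j%:R = (p ^ logn p j)%N%:R * (j`_p^')%N%:R :> rat.
  by rewrite -natrM -p_part partnC.
by rewrite natrM; ring.
Qed.

Lemma ZlocP p x : prime p -> reflect (Zloc_ideal p 0 x) (Zloc p x).
Proof.
move=> pp; apply: (iffP idP) => [px|[b [z [pb xb]]]].
  exists `|denq x|%N, (numq x); split=> //.
  by rewrite expn0 mul1r numqE pmulrn gez0_abs.
apply: contra pb => /dvdn_trans; apply.
have: x * b%:R = z%:~R by rewrite xb expn0 mul1r.
rewrite -{1}(divq_num_den x) mulrAC => /(canRL (divfK _)).
rewrite intr_eq0 denq_eq0 => /(_ isT)/eqP.
rewrite pmulrn -!rmorphM eqr_int /= => /eqP h.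
have: (denq x %| numq x * b%:Z)%Z by rewrite h dvdz_mull.
rewrite Gauss_dvdzr ?dvdzE //.
by rewrite coprimezE coprime_sym coprime_num_den.
Qed.

Lemma congr_ZlocP p e x y : prime p -> Zloc p x -> Zloc p y ->
  Zloc_ideal p e (x - y) -> congr_Zloc p (p ^ e) x y.
Proof.
move=> pp px py [b [z [pb xyb]]].
have b0 : b%:R != 0 :> rat.
  by rewrite pnatr_eq0; apply: contra pb => /eqP->; rewrite dvdn0.
split=> //; exists (z%:~R / b%:R).
  by apply/(ZlocP _ pp); exists b, z; split=> //; rewrite expn0 mul1r divfK.
by apply: (mulIf b0); rewrite xyb -mulrA divfK.
Qed.

(** * Binomial coefficients modulo prime powers *)

Lemma coef_add1Xn (R : nzRingType) n k :
  ((1 + 'X : {poly R}) ^+ n)`_k = 'C(n, k)%:R.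
Proof.
elim: n k => [|n IH] k; first by rewrite expr0 coef1 bin0n.
rewrite exprS mulrDl mul1r coefD coefXM IH; case: k => [|k] /=.
  by rewrite !bin0 addr0.
by rewrite IH binS natrD.
Qed.

Lemma exprD_linear (R : comNzRingType) (y w : R) n :
  exists t, (y + w) ^+ n.+1 = y ^+ n.+1 + n.+1%:R * y ^+ n * w + w ^+ 2 * t.
Proof.
elim: n => [|n [t IH]]; first by exists 0; ring.
exists (y * t + n.+1%:R * y ^+ n + w * t).
by rewrite exprS IH !exprS -natr1; ring.
Qed.

Lemma expr_mod (R : comNzRingType) (m x y z : R) n :
  x = y + m * z -> exists t, x ^+ n = y ^+ n + m * t.
Proof.
move=> ->; elim: n => [|n [t IH]]; first by exists 0; ring.
by exists (y * t + z * (y ^+ n + m * t)); rewrite exprS IH exprS; ring.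
Qed.

(** In the expansion of [(y + w) ^+ p] with [w = p^(e+1) z], the linear term gains a factor [p], and
    [w ^+ 2] is divisible by [p^(2e+2)]. *)
Lemma expr_mod_prime_pow (R : comNzRingType) p e (x y z : R) : prime p ->
  x = y + (p ^ e.+1)%N%:R * z -> exists t, x ^+ p = y ^+ p + (p ^ e.+2)%N%:R * t.
Proof.
move=> pp ->; case: p pp => // p pp.
have [t ->] := exprD_linear y ((p.+1 ^ e.+1)%N%:R * z) p.
exists (y ^+ p * z + (p.+1 ^ e)%N%:R * z ^+ 2 * t).
by rewrite !natrX !exprS; ring.
Qed.

Lemma add1Xn_mod_prime p : prime p ->
  exists t : {poly int}, (1 + 'X) ^+ p = 1 + 'X^p + p%:R * t.
Proof.
move=> pp; pose c i := if (0 < i < p)%N then ('C(p, i) %/ p)%N%:R else 0 : int.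
exists (\poly_(i < p) c i); apply/polyP=> i.
rewrite coef_add1Xn mulr_natl !coefD coefMn coef1 coefXn coef_poly /c.
have p0 := prime_gt0 pp.
case: (ltngtP i p) => [ip|ip|->] /=; last first.
- by rewrite binn mul0rn !addr0 (gtn_eqF p0) add0r.
- by rewrite bin_small // (gtn_eqF (leq_ltn_trans _ ip)) // mul0rn !addr0.
case: (posnP i) => [->|i0] /=; first by rewrite bin0 mul0rn !addr0.
by rewrite !add0r -mulrnA divnK // prime_dvd_bin // i0.
Qed.

Lemma add1Xn_mod_prime_pow p s : prime p ->
  exists t : {poly int},
    (1 + 'X) ^+ (p ^ s.+1) = (1 + 'X^p) ^+ (p ^ s) + (p ^ s.+1)%N%:R * t.
Proof.
move=> pp; elim: s => [|s [t IH]].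
  by have [t h] := add1Xn_mod_prime pp; exists t; rewrite expn1 expn0 expr1.
have [u h] := expr_mod_prime_pow pp IH.
by exists u; rewrite [in LHS]expnSr exprM h -exprM -expnSr.
Qed.

(** For [N = M p^s], raising the preceding congruence to the power [M] gives
    [(1 + X)^(pN) = (1 + X^p)^N] modulo [p^(s+1)]; compare the coefficients of [X^(pK)]. *)
Lemma bin_mod_prime_pow p s N K : prime p -> (p ^ s %| N)%N ->
  exists z : int, 'C(p * N, p * K)%:Z - 'C(N, K)%:Z = (p ^ s.+1)%N%:Z * z.
Proof.
move=> pp /dvdnP[M ->]; have p0 := prime_gt0 pp.
have [t ht] := add1Xn_mod_prime_pow s pp.
have [v /(congr1 (fun q : {poly int} => q`_(p * K)))] := expr_mod M ht.
rewrite -!exprM !(mulnC _ M) expnS mulnCA -expnS.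
rewrite coef_add1Xn coefD mulr_natl coefMn -[_ *+ (p ^ _)%N]mulr_natl => h.
exists v`_(p * K).
have e : 1 + 'X^p = (1 + 'X : {poly int}) \Po 'X^p.
  by rewrite comp_polyD comp_polyX -polyC1 comp_polyC.
move: h; rewrite e -rmorphXn /= coef_comp_poly_Xn // dvdn_mulr // mulKn // coef_add1Xn.
by rewrite !natz => ->; ring.
Qed.

(** * The coefficients [half_bin], [p]-adically *)

(* 2 C(j/2, j), the coefficient of u^j in u / sqrt (1 + u^2 / 4). *)
Definition half_bin (j : nat) : rat :=
  2 * (\prod_(i < j) (j%:R / 2 - i%:R)) / j`!%:R.

Lemma natr_ffact (R : nzRingType) n j : (j <= n)%N ->
  (n ^_ j)%N%:R = \prod_(i < j) (n%:R - i%:R) :> R.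
Proof.
move=> jn; rewrite ffact_prod natr_prod; apply: eq_bigr => i _.
by rewrite natrB // (leq_trans _ jn) // ltnW.
Qed.

Lemma Zloc_ideal_prodB p e j (x y : nat -> rat) : prime p ->
  (forall i, Zloc_ideal p 0 (x i)) -> (forall i, Zloc_ideal p 0 (y i)) ->
  (forall i, Zloc_ideal p e (x i - y i)) ->
  Zloc_ideal p e (\prod_(i < j) x i - \prod_(i < j) y i).
Proof.
move=> pp Ix Iy Ixy.
have Ipr (z : nat -> rat) n : (forall i, Zloc_ideal p 0 (z i)) ->
    Zloc_ideal p 0 (\prod_(i < n) z i).
  move=> Iz; elim/big_ind: _ => //; first exact: (@Zloc_ideal_int p 1).
  by move=> *; apply: Zloc_idealMl.
elim: j => [|j IH]; first by rewrite !big_ord0 subrr; apply: Zloc_ideal0.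
rewrite !big_ord_recr /=; set X := \prod_(i < j) x i; set Y := \prod_(i < j) y i.
have -> : X * x j - Y * y j = (X - Y) * x j + Y * (x j - y j) by ring.
apply: Zloc_idealD => //; first exact: Zloc_idealMr.
by apply: Zloc_idealMl => //; apply: Ipr.
Qed.

(* M = (1 + p^L) / 2 is an integer p-adically close to 1 / 2. *)
Lemma half_bin_approx p e L j : prime p -> odd p -> (e + logn p j`! <= L)%N ->
  Zloc_ideal p e (half_bin j - 2 * 'C(j * (p ^ L).+1./2, j)%:R).
Proof.
move=> pp op eL; set M := (_./2).
have M2 : (M%:R * 2 = 1 + (p ^ L)%N%:R :> rat).
  rewrite -natrM muln2 nat1r; congr (_%:R).
  by rewrite even_halfK /= ?oddX ?op ?orbT.
have M0 : (0 < M)%N by rewrite half_gt0 ltnS expn_gt0 prime_gt0.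
have jM : (j <= j * M)%N by rewrite leq_pmulr.
(* Clearing [j!] loses [logn p j!] powers of [p], which the bound on [L] pays for; what remains are
   two products whose factors differ by [- (j / 2) p^L]. *)
apply: (@Zloc_ideal_div p _ (j`!)) => //; first exact: fact_gt0.
apply: Zloc_ideal_le eL _.
have f0 : j`!%:R != 0 :> rat by rewrite pnatr_eq0 -lt0n fact_gt0.
rewrite mulrBl divfK // -mulrA -natrM bin_ffact natr_ffact // -mulrBr.
apply: Zloc_idealMl => //; first exact: (@Zloc_ideal_int p 2).
have Ihalf := Zloc_ideal_half pp op.
apply: (@Zloc_ideal_prodB _ _ _ (fun i => j%:R / 2 - i%:R)
          (fun i => (j * M)%N%:R - i%:R)) => // i.
- apply: Zloc_idealB => //; last exact: Zloc_ideal_nat.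
  by rewrite -[2^-1]mul1r; apply: Zloc_idealMl => //; apply: Zloc_ideal_nat.
- by apply: Zloc_idealB => //; apply: Zloc_ideal_nat.
have -> : j%:R / 2 - i%:R - ((j * M)%:R - i%:R) =
    (- (j%:R * (1 / 2))) * (p ^ L)%N%:R :> rat.
  have -> : (p ^ L)%N%:R = M%:R * 2 - 1 :> rat by rewrite M2; ring.
  by rewrite natrM; field.
apply: Zloc_idealMl => //; last exact: Zloc_ideal_dvd.
by apply: Zloc_idealN; apply: Zloc_idealMl => //; apply: Zloc_ideal_nat.
Qed.

Lemma half_bin_loc p j : prime p -> odd p -> Zloc_ideal p 0 (half_bin j).
Proof.
move=> pp op;
rewrite -(subrK (2 * 'C(j * (p ^ (0 + logn p j`!)).+1./2, j)%:R) (half_bin j)).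
apply: Zloc_idealD => //; first exact: half_bin_approx.
by rewrite -natrM; apply: Zloc_ideal_nat.
Qed.

(** Approximating both values with one common [M] reduces the claim to [bin_mod_prime_pow] for
    [C(p i M, p i)] and [C(i M, i)]. *)
Lemma half_bin_gauss p i : prime p -> odd p -> (0 < i)%N ->
  Zloc_ideal p (logn p i).+1 (half_bin (p * i) - half_bin i).
Proof.
move=> pp op i0; set e := (logn p i).+1; pose L := (e + logn p (p * i)`!)%N.
have A1 := @half_bin_approx p e L (p * i) pp op (leqnn _).
have A2 : Zloc_ideal p e (half_bin i - 2 * 'C(i * (p ^ L).+1./2, i)%:R).
  (* The [L] chosen for [p * i] also serves [i], since [i!] divides [(p * i)!]. *)
  apply: half_bin_approx => //; rewrite leq_add2l dvdn_leq_log ?fact_gt0 //.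
  have ipi : (i <= p * i)%N by rewrite leq_pmull // prime_gt0.
  by rewrite -(bin_fact ipi) mulnCA dvdn_mulr.
move: A1 A2; set M := (_./2) => A1 A2.
have pi : (p ^ logn p i %| i * M)%N by rewrite dvdn_mulr // pfactor_dvdnn.
have [z hz] := bin_mod_prime_pow i pp pi.
have hz' : 'C(p * i * M, p * i)%:R - 'C(i * M, i)%:R = (p ^ e)%N%:R * z%:~R :> rat.
  by rewrite -mulnA !pmulrn -rmorphB /= hz rmorphM.
have -> : half_bin (p * i) - half_bin i =
   (half_bin (p * i) - 2 * 'C(p * i * M, p * i)%:R)
   - (half_bin i - 2 * 'C(i * M, i)%:R)
   + (p ^ e)%N%:R * (2 * z%:~R) by rewrite mulrCA -hz'; ring.
apply: Zloc_idealD => //; first exact: Zloc_idealB.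
apply: Zloc_idealMr => //; first exact: Zloc_ideal_dvd.
by apply: Zloc_idealMl => //; [apply: (@Zloc_ideal_int p 2)|apply: Zloc_ideal_int].
Qed.

(** * The closed form of the sequence: integrality and congruences *)

(** For [0 < j <= n], the coefficient of [x^n] in [half_bin j / j] times [x d/dx (u^j)]. For [j > n]
    the truncated [n - j] gives a wrong value, so sums must stop at [n]. *)
Definition cterm (n j : nat) : rat :=
  half_bin j * (n%:R / j%:R) * 'C(j, n - j)%:R.

Definition cseq (n : nat) : rat := \sum_(1 <= j < n.+1) cterm n j.

Lemma cterm_nat n j : (0 < j <= n)%N ->
  exists m : nat, n%:R / j%:R * 'C(j, n - j)%:R = m%:R :> rat.
Proof.
case/andP=> j0 jn; have j0' : j%:R != 0 :> rat by rewrite pnatr_eq0 -lt0n.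
rewrite -{1}(subnKC jn); case: (n - j)%N => [|k].
  by exists 1%N; rewrite addn0 divff // bin0 mulr1.
(* With [n = j + k + 1], the factor [n / j] is [1 + (k + 1) / j], and
   [(k + 1) C(j, k + 1) = j C(j - 1, k)]. *)
exists ('C(j, k.+1) + 'C(j.-1, k))%N; apply: (mulfI j0').
by rewrite [in RHS]natrD mulrDr -!natrM mul_bin_diag !natrM natrD; field.
Qed.

Lemma cseq_loc p n : prime p -> odd p -> Zloc_ideal p 0 (cseq n).
Proof.
move=> pp op; rewrite /cseq big_nat; apply: Zloc_ideal_sum => // j jn.
have [m hm] := @cterm_nat n j jn.
rewrite /cterm -mulrA hm; apply: Zloc_idealMl => //; last exact: Zloc_ideal_nat.
exact: half_bin_loc.
Qed.

Lemma Zloc_ideal_divn p e n j x : prime p -> (0 < j)%N -> (p ^ e %| n)%N ->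
  Zloc_ideal p (logn p j).+1 x -> Zloc_ideal p e.+1 (n%:R / j%:R * x).
Proof.
move=> pp j0 pn Ix; rewrite -mulrA [j%:R^-1 * x]mulrC -addn1.
apply: Zloc_idealM => //; first exact: Zloc_ideal_dvd.
by apply: (Zloc_ideal_div pp j0); rewrite divfK // pnatr_eq0 -lt0n.
Qed.

Lemma sum_multiples (V : zmodType) p m (F G : nat -> V) : (0 < p)%N ->
  \sum_(1 <= j < (p * m).+1) F j - \sum_(1 <= i < m.+1) G i =
  \sum_(1 <= j < (p * m).+1 | ~~ (p %| j)%N) F j +
  \sum_(1 <= i < m.+1) (F (p * i)%N - G i).
Proof.
move=> p0; rewrite sumrB addrA; congr (_ - _).
rewrite (bigID (fun j => p %| j)%N) /= addrC; congr (_ + _).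
elim: m => [|m IH]; first by rewrite muln0 !big_geq.
rewrite [RHS]big_nat_recr //= -IH mulnS addnC.
(* Passing from [m] to [m + 1] adds a block of [p] indices, of which only the last is a multiple of
   [p]. *)
rewrite (@big_cat_nat _ _ _ (p * m).+1) //= ?ltnS ?leq_addr //; congr (_ + _).
rewrite big_mkcond big_nat_recr /=; last by rewrite -[X in (X < _)%N]addn0 ltn_add2l.
rewrite dvdn_addr ?dvdn_mulr // dvdnn big_nat big1 ?add0r // => j /andP[h1 h2].
case: ifP => // /dvdnP[k jk]; move: h1 h2; rewrite jk (mulnC p) addnC -mulSn.
by rewrite !ltn_pmul2r // ltnS => h /(leq_trans h); rewrite ltnn.
Qed.

Lemma cseq_gauss p r m : prime p -> odd p -> (p ^ r %| m)%N ->
  Zloc_ideal p r.+1 (cseq (p * m) - cseq m).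
Proof.
move=> pp op pm; have p0 := prime_gt0 pp.
have ppm : (p ^ r.+1 %| p * m)%N by rewrite expnS dvdn_pmul2l.
rewrite /cseq sum_multiples //; apply: Zloc_idealD => //.
  (* Here [j] is prime to [p], so [p m / j] alone supplies [p^(r+1)]. *)
  rewrite big_nat_cond; apply: Zloc_ideal_sum => // j /andP[/andP[j0 _] pj].
  have lj : logn p j = 0%N.
    apply/eqP; by rewrite -leqn0 leqNgt logn_gt0 mem_primes pp j0.
  rewrite /cterm; apply: Zloc_idealMr => //; last exact: Zloc_ideal_nat.
  apply: Zloc_idealMl => //; first exact: half_bin_loc.
  apply: (Zloc_ideal_div pp j0); rewrite lj addn0 divfK ?pnatr_eq0 -?lt0n //.
  exact: Zloc_ideal_dvd.
rewrite big_nat; apply: Zloc_ideal_sum => // i /andP[i0 im].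
have i0' : i%:R != 0 :> rat by rewrite pnatr_eq0 -lt0n.
have p0' : p%:R != 0 :> rat by rewrite pnatr_eq0 -lt0n.
rewrite /cterm -mulnBr.
set B := 'C(p * i, _); set B' := 'C(i, _).
(* For [j = p i] the ratio [p m / (p i)] is [m / i]. The bracket is divisible by [p^(v(i)+1)], which
   offsets the division by [i] and leaves one extra [p]. *)
have -> : half_bin (p * i) * ((p * m)%N%:R / (p * i)%N%:R) * B%:R -
    half_bin i * (m%:R / i%:R) * B'%:R =
    m%:R / i%:R * ((half_bin (p * i) - half_bin i) * B%:R +
      half_bin i * (B%:R - B'%:R)) :> rat.
  by rewrite !natrM; field; rewrite i0'.
apply: Zloc_ideal_divn => //; apply: Zloc_idealD => //.
  by apply: Zloc_idealMr => //; [exact: half_bin_gauss|exact: Zloc_ideal_nat].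
apply: Zloc_idealMl => //; first exact: half_bin_loc.
have [z hz] := bin_mod_prime_pow (m - i) pp (pfactor_dvdnn p i).
rewrite !pmulrn -rmorphB /= hz rmorphM /= -pmulrn.
apply: Zloc_idealMr => //; first exact: Zloc_ideal_dvd.
exact: Zloc_ideal_int.
Qed.

Lemma denq_cseq n : exists m : nat, denq (cseq n) = (2 ^ m)%N%:Z.
Proof.
have d0 : (0 < `|denq (cseq n)|)%N by rewrite absz_gt0 denq_eq0.
have /p_natP[m hm] : (2%N).-nat `|denq (cseq n)|%N.
  apply/pnatP => // p pp pd; rewrite inE /=; apply: contraTT pd => p2.
  have op : odd p by case: (even_prime pp) p2 => // ->.
  exact/ZlocP/cseq_loc.
by exists m; rewrite -hm gez0_abs.
Qed.

(** * The generating function, its differential equation and the recurrence *)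

Definition upoly : {poly rat} := 'X + 'X^2.
Definition disc : {poly rat} := 4%:P + upoly ^+ 2.
(* Truncations of 2 / sqrt disc, as a series in upoly, and of the generating
   function of cseq. *)
Definition isqrt (N : nat) : {poly rat} := \sum_(j < N) half_bin j.+1 *: upoly ^+ j.
Definition gen_poly (N : nat) : {poly rat} := 'X * upoly^`() * isqrt N.

Lemma half_bin1 : half_bin 1 = 1.
Proof. by rewrite /half_bin big_ord_recl big_ord0 (factS 0) fact0 /=; field. Qed.

Lemma half_bin2 : half_bin 2 = 0.
Proof. by rewrite /half_bin big_ord_recr /= divff // subrr !mulr0 mul0r. Qed.

(** Once the first and last factors of the longer product are removed, the shift
    [(j+3)/2 - (i+1) = (j+1)/2 - i] identifies the rest with the shorter one. *)
Lemma half_binSS j : 4 * j.+2%:R * half_bin j.+3 = - j.+1%:R * half_bin j.+1.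
Proof.
rewrite /half_bin big_ord_recl big_ord_recr /=.
have -> : \prod_(i < j.+1) (j.+3%:R / 2 - (bump 0 i)%:R) =
   \prod_(i < j.+1) (j.+1%:R / 2 - i%:R) :> rat.
  by apply: eq_bigr => i _; rewrite /bump /= add1n -!natr1; field.
have f0 : j.+1`!%:R != 0 :> rat by rewrite pnatr_eq0 -lt0n fact_gt0.
rewrite (factS j.+2) (factS j.+1) /bump /=; move: (j.+1)`! f0 => f f0.
rewrite !natrM; set P := \prod_(i < _) _; rewrite -!natr1; field.
by rewrite f0 !natr1 !pnatr_eq0.
Qed.

Lemma deriv_upoly : upoly^`() = 1 + 2%:P * 'X.
Proof. by rewrite /upoly derivD derivX derivXn /= expr1 polyC_natr mulr_natl. Qed.

(** The full series [2 / sqrt disc] makes the left side zero. For the truncation, [half_binSS]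
    cancels all lower powers of [upoly] and leaves the boundary terms on the right. *)
Lemma isqrt_ode N :
  disc * (isqrt N.+1)^`() + upoly * upoly^`() * isqrt N.+1 =
  - 4%:P * upoly^`() * ((N.+1%:R * half_bin N.+2)%:P * upoly ^+ N
                    + (N.+2%:R * half_bin N.+3)%:P * upoly ^+ N.+1).
Proof.
have step j : 4%:P * (j.+2%:R * half_bin j.+3)%:P = - (j.+1%:R * half_bin j.+1)%:P.
  by rewrite -polyCM mulrA half_binSS mulNr polyCN.
elim: N => [|N IH].
  rewrite /isqrt big_ord_recl big_ord0 addr0 /= half_bin1 scale1r expr0 derivC.
  rewrite half_bin2.
  transitivity (- (4%:P * (2 * half_bin 3)%:P) * upoly^`() * upoly); last by ring.
  by rewrite step half_bin1 mulr1 polyC1; ring.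
(* The coefficient is written as [(N + 2) - (N + 1)] times itself, so that [half_binSS] applies to
   the first part. *)
have hb : (half_bin N.+2)%:P =
    - (4%:P * (N.+3%:R * half_bin N.+4)%:P) - (N.+1%:R * half_bin N.+2)%:P.
  by rewrite step opprK -polyCB -mulrBl -natrB // subSnn mul1r.
have dS : (half_bin N.+2 *: upoly ^+ N.+1)^`() =
    (N.+1%:R * half_bin N.+2)%:P * upoly ^+ N * upoly^`().
  by rewrite derivZ deriv_exp /= -mul_polyC -mulr_natl [in RHS]polyCM polyC_natr; ring.
have -> : isqrt N.+2 = isqrt N.+1 + half_bin N.+2 *: upoly ^+ N.+1.
  by rewrite /isqrt big_ord_recr.
rewrite derivD !mulrDr addrACA IH dS -mul_polyC hb /disc !exprS; ring.
Qed.

Lemma dvdXnP (F : fieldType) n (p : {poly F}) :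
  reflect (forall i, (i < n)%N -> p`_i = 0) ('X^n %| p).
Proof.
apply: (iffP idP) => [/dvdpP[q ->] i ni|h]; first by rewrite coefMXn ni.
apply/dvdpP; exists (drop_poly n p); rewrite -[LHS](poly_take_drop n).
rewrite (_ : take_poly n p = 0) ?add0r //.
by apply/polyP => i; rewrite coef_take_poly coef0; case: ifP => // /h.
Qed.

Lemma isqrt_ode_dvd N :
  'X^N %| disc * (isqrt N.+1)^`() + upoly * upoly^`() * isqrt N.+1.
Proof.
apply: (@dvdp_trans _ (upoly ^+ N)).
  rewrite (_ : upoly = 'X * (1 + 'X)); last by rewrite /upoly; ring.
  by rewrite exprMn dvdp_mulr.
rewrite isqrt_ode; apply: dvdp_mull.
by rewrite dvdp_add ?dvdp_mull // exprS dvdp_mull.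
Qed.

Lemma coef_upolyX j n : (upoly ^+ j)`_n = if (j <= n)%N then 'C(j, n - j)%:R else 0.
Proof.
have -> : upoly = 'X * (1 + 'X) by rewrite /upoly; ring.
by rewrite exprMn coefXnM coef_add1Xn ltnNge; case: leqP.
Qed.

Lemma coef_gen_poly N n : (n <= N)%N -> (gen_poly N)`_n = cseq n.
Proof.
move=> nN; rewrite /gen_poly /isqrt /cseq big_add1 big_mkord mulr_sumr coef_sum.
rewrite (big_ord_widen_cond _ predT (fun i => cterm n i.+1) nN) [RHS]big_mkcond /=.
apply: eq_bigr => j _; have j0 : j.+1%:R != 0 :> rat by rewrite pnatr_eq0.
(* Each summand is rewritten as [x d/dx] of a power of [upoly]; powers above [n] do not reach [x^n],
   so the truncation is harmless. *)
have -> : 'X * upoly^`() * (half_bin j.+1 *: upoly ^+ j) =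
    (half_bin j.+1 / j.+1%:R) *: ('X * (upoly ^+ j.+1)^`()).
  rewrite -{1}(divfK j0 (half_bin j.+1)); move: (half_bin _ / _) => q.
  by rewrite deriv_exp /= -!mul_polyC polyCM polyC_natr -[upoly^`() * _ *+ _]mulr_natr;
     ring.
rewrite coefZ coefXM; case: n nN => [|n] nN /=; first by rewrite mulr0.
rewrite coef_deriv coef_upolyX -[_ *+ n.+1]mulr_natl /cterm !ltnS; case: leqP => _ //.
  by rewrite subSS !mulrA; congr (_ * _); rewrite mulrAC.
by rewrite !mulr0.
Qed.

Lemma cseq_rec n :
       4 * (n + 4)%:R * cseq (n + 5)%N
     + 8 * (n + 2)%:R * cseq (n + 4)%N
     + (n + 3)%:R * cseq (n + 3)%N
     + (4 * n + 7)%:R * cseq (n + 2)%N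
     + (5 * n + 4)%:R * cseq (n + 1)%N
     + 2 * n%:R * cseq n = 0.
Proof.
(* Logarithmic differentiation of [f = 2 x u' / sqrt disc] gives [P x f' = Q f] with [P = disc u']
   and [Q = disc (u' + x u'') - x u u'^2], expanded here. *)
pose P : {poly rat} := 4%:P + 8%:P * 'X + 'X^2 + 4%:P * 'X^3
  + 5%:P * 'X^4 + 2%:P * 'X^5.
pose Q : {poly rat} := 4%:P + 16%:P * 'X + 'X^3 + 'X^4.
pose f := gen_poly (n + 6).+1.
have ode : 'X^(n + 6) %| P * ('X * f^`()) - Q * f.
  have -> : P * ('X * f^`()) - Q * f =
     'X^2 * upoly^`() ^+ 2 * (disc * (isqrt (n + 6).+1)^`()
       + upoly * upoly^`() * isqrt (n + 6).+1).
    have dU' : upoly^`()^`() = 2%:P.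
      by rewrite deriv_upoly -polyC1 derivD derivC derivM derivC derivX; ring.
    by rewrite /f /gen_poly !derivM derivX dU' deriv_upoly /P /Q /disc /upoly; ring.
  exact/dvdp_mull/isqrt_ode_dvd.
have cf m : (m <= n + 5)%N -> f`_m = cseq m.
  by move=> mn; rewrite coef_gen_poly // (leq_trans mn) // -addnS leq_add2l.
have theta m : ('X * f^`())`_m = m%:R * f`_m.
  by rewrite coefXM; case: m => [|m]; rewrite ?mul0r // coef_deriv mulr_natl.
(* The coefficient of [X^(n+5)] in this equation is the recurrence at [n]. *)
move/dvdXnP/(_ (n + 5)%N): ode; rewrite ltn_add2l => /(_ isT) H.
have {H} : 4 * ((n + 5)%:R * f`_(n + 5)) + 8 * ((n + 4)%:R * f`_(n + 4)) +
    (n + 3)%:R * f`_(n + 3) + 4 * ((n + 2)%:R * f`_(n + 2)) +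
    5 * ((n + 1)%:R * f`_(n + 1)) + 2 * (n%:R * f`_n) -
    (4 * f`_(n + 5) + 16 * f`_(n + 4) + f`_(n + 2) + f`_(n + 1)) = 0.
  rewrite -!theta -[RHS]H coefB /P /Q !(@mulrDl {poly rat}) !coefD.
  rewrite -!(@mulrA {poly rat}) !coefCM.
  by rewrite !addnS addn0 !coefXM.
rewrite !cf ?leq_add2l ?leq_addr // => H; rewrite -[RHS]H.
by rewrite (natrD _ (4 * n)) (natrD _ (5 * n)) !natrM !natrD; ring.
Qed.

(** * No recurrence with constant coefficients *)

(** The derivative is [2 * isqrt N.+1] times the left side of the differential equation, hence
    vanishes to order [N]; the constant term is checked at 0. *)
Lemma isqrt_sqr N : 'X^N %| isqrt N.+1 ^+ 2 * disc - 4%:P.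
Proof.
set Q := _ - _; apply/dvdXnP => -[_|i iN].
  have U0 : upoly.[0] = 0 by rewrite /upoly !hornerE.
  have S0 : (isqrt N.+1).[0] = 1.
    rewrite /isqrt horner_sum big_ord_recl big1 /=; first by rewrite half_bin1 !hornerE.
    by move=> j _; rewrite hornerZ horner_exp U0 exprS mul0r mulr0.
  rewrite /Q /disc -horner_coef0 hornerD hornerN hornerM hornerD.
  rewrite !horner_exp U0 S0 !hornerC.
  ring.
have Q' : Q^`() = 2%:P * isqrt N.+1 *
    (disc * (isqrt N.+1)^`() + upoly * upoly^`() * isqrt N.+1).
  by rewrite /Q /disc !expr2 derivB derivM derivD !derivC !derivM; ring.
have dvQ : 'X^N %| Q^`() by rewrite Q' dvdp_mull // isqrt_ode_dvd.
move/dvdXnP/(_ i (ltnW iN))/eqP: dvQ.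
by rewrite coef_deriv mulrn_eq0 /= => /eqP.
Qed.

Lemma coprime_disc_deriv : coprimep disc disc^`().
Proof.
have -> : disc^`() = 2%:P * (upoly * upoly^`()).
  by rewrite /disc derivD derivC expr2 derivM; ring.
rewrite mul_polyC coprimepZr // coprimepMr; apply/andP; split.
  apply/Bezout_coprimepP; exists (1, - upoly).
  by rewrite (_ : _ + _ = 4%:P) ?polyC_eqp1 // /disc /=; ring.
(* Since [4 u = u'^2 - 1], one has [16 disc = 64 + (u'^2 - 1)^2 = 65 + u'^2 (u'^2 - 2)]. *)
apply/Bezout_coprimepP; exists (16%:P, - upoly^`() * (upoly^`() ^+ 2 - 2%:P)).
by rewrite (_ : _ + _ = 65%:P) ?polyC_eqp1 // deriv_upoly /disc /upoly /=; ring.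
Qed.

(** After division by the gcd, [A ^+ 2] divides the coprime [B ^+ 2], so it is constant and [d] is a
    scalar multiple of [B ^+ 2]. Then [B] divides both [d] and its derivative, which forces [d] to
    be constant. *)
Lemma separable_nonsquare (F : numFieldType) (d A B : {poly F}) :
  coprimep d d^`() -> (1 < size d)%N -> B != 0 -> d * A ^+ 2 = B ^+ 2 -> False.
Proof.
move=> cd sd B0 e.
pose G := gcdp A B; have G0 : G != 0 by rewrite gcdp_eq0 negb_and B0 orbT.
have cAB : coprimep (A %/ G) (B %/ G) by apply: coprimep_div_gcd; rewrite B0 orbT.
have {e} : d * (A %/ G) ^+ 2 = (B %/ G) ^+ 2.
  apply: (mulIf (expf_neq0 2 G0)).
  by rewrite -mulrA -!exprMn !divpK ?dvdp_gcdl ?dvdp_gcdr.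
move: (A %/ G) (B %/ G) cAB => {A B B0 G G0} A B cAB e.
have cAB2 : coprimep (A ^+ 2) (B ^+ 2) by rewrite coprimep_expl // coprimep_expr.
have : size (A ^+ 2) == 1%N.
  by rewrite -dvdp1 -(Gauss_dvdpr _ cAB2) mulr1 -e dvdp_mull.
case/size_poly1P => c c0 Ac; move: e; rewrite Ac mulrC mul_polyC => e.
have dB : d = B * (c^-1 *: B) by rewrite -scalerAr -expr2 -e scalerA mulVf ?scale1r.
have Bd : B %| d by rewrite dB dvdp_mulr.
have Bd' : B %| d^`().
  rewrite dB derivM dvdp_add //; last by rewrite dvdp_mulr.
  by rewrite -scalerAr dvdpZr ?invr_eq0 // dvdp_mull.
have /size_poly1P[b b0 Bb] : size B == 1%N.
  by rewrite size_poly_eq1; move/coprimepP: cd => /(_ B Bd Bd').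
by move: sd; rewrite dB Bb -mul_polyC -!polyCM size_polyC; case: eqP.
Qed.

Lemma cseq_not_constant_recurrence (F : numFieldType) :
  ~ has_constant_recurrence (fun n : nat => ratr (cseq n) : F).
Proof.
case=> d [a rec]; pose phi := map_poly (ratr : rat -> F).
pose V : {poly rat} := 2%:P * 'X * upoly^`();
(* [N] exceeds the degrees of both sides of [sqr] below, so that a congruence modulo [X^N] becomes
   an equality. *)
pose N := (2 * d + 10)%N; pose W := phi (gen_poly N.+1).
(* The reversed characteristic polynomial: its product with the generating series has no terms of
   degree [d] or more. *)
pose B : {poly F} := 1 - \sum_(i < d) a i *: 'X^(d - i).
have B0 : B`_0 = 1.
  rewrite coefB coef1 coef_sum big1 ?subr0 // => i _.
  by rewrite coefZ coefXn eq_sym subn_eq0 leqNgt ltn_ord mulr0.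
have Bsize : (size B <= d.+1)%N.
  rewrite (leq_trans (size_polyD _ _)) // geq_max size_poly1 size_polyN /=.
  apply: (leq_trans (size_sum _ _ _)); apply/bigmax_leqP => i _.
  by rewrite (leq_trans (size_scale_leq _ _)) // size_polyXn ltnS leq_subr.
pose A := take_poly d (B * W).
have BW : 'X^N %| B * W - A.
  apply/dvdXnP => m mN; rewrite coefB coef_take_poly.
  case: ltnP => dm; first by rewrite subrr.
  rewrite subr0 mulrBl mul1r coefB mulr_suml coef_sum.
  have cW k : (k <= m)%N -> W`_k = ratr (cseq k).
    by move=> km; rewrite /W coef_map /= coef_gen_poly // (leq_trans km) // ltnW // ltnW.
  rewrite cW // -{1}(subnK dm) rec; apply/eqP; rewrite subr_eq0; apply/eqP.
  apply: eq_bigr => i _; rewrite -scalerAl coefZ coefXnM.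
  rewrite ltnNge (leq_trans (leq_subr _ _) dm) /=; have id := ltnW (ltn_ord i).
  by rewrite cW ?leq_subr // subnBA // addnBAC.
have sqr : phi disc * A ^+ 2 = (phi V * B) ^+ 2.
  apply/eqP; rewrite -subr_eq0; apply/eqP.
  have h : 'X^N %| phi disc * A ^+ 2 - (phi V * B) ^+ 2.
    have := isqrt_sqr N; rewrite -(dvdp_map (ratr : {rmorphism rat -> F})) map_polyXn.
    rewrite rmorphB rmorphM rmorphXn /= -/phi => h.
    (* The first multiple of [X^N] trades [isqrt^2 * disc] for 4, the second trades [(B * W)^2] for
       [A^2]. *)
    have -> : phi disc * A ^+ 2 - (phi V * B) ^+ 2 =
      (phi ('X * upoly^`()) * B) ^+ 2 *
        (phi (isqrt N.+1) ^+ 2 * phi disc - phi 4%:P)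
      - phi disc * (A + B * W) * (B * W - A).
      by rewrite /W /gen_poly /V /phi !rmorphM /= !map_polyC /= !ratr_nat -/phi; ring.
    by rewrite dvdp_sub // dvdp_mull.
  apply: contraTeq h => h0; apply/negP => /(dvdp_leq h0); rewrite size_polyXn leqNgt ltnS.
  move/negP; apply; rewrite (leq_trans (size_polyD _ _)) // geq_max size_polyN.
  have sexp (q : {poly F}) k : (size q <= k.+1)%N -> (size (q ^+ 2) <= (2 * k).+1)%N.
    move=> qk; apply: leq_trans (size_poly_exp_leq _ _) _.
    by move: (size q) qk => x; lia.
  have sU : (size upoly <= 3)%N.
    by rewrite (leq_trans (size_polyD _ _)) // size_polyX size_polyXn.
  have sV : (size (phi V) <= 3)%N.
    rewrite size_map_poly /V deriv_upoly.
    have -> : 2%:P * 'X * (1 + 2%:P * 'X) = 2 *: 'X + 4 *: 'X^2 :> {poly rat}.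
      by rewrite -!mul_polyC; ring.
    rewrite (leq_trans (size_polyD _ _)) // geq_max.
    by rewrite !(leq_trans (size_scale_leq _ _)) ?size_polyX ?size_polyXn.
  have sD : (size (phi disc) <= 5)%N.
    rewrite /disc /phi rmorphD rmorphXn /= map_polyC.
    rewrite (leq_trans (size_polyD _ _)) // geq_max.
    by rewrite (leq_trans (size_polyC_leq1 _)) // (sexp _ 2%N) // size_map_poly.
  have sA : (size (A ^+ 2) <= (2 * d).+1)%N.
    by apply: sexp; rewrite (leq_trans (size_take_poly _ _)).
  have sVB : (size ((phi V * B) ^+ 2) <= (2 * d.+2).+1)%N.
    apply: sexp; apply: leq_trans (size_polyMleq _ _) _.
    by move: (leq_add sV Bsize); move: (_ + size _)%N => x; lia.
  apply/andP; split; last by apply: (leq_trans sVB); rewrite /N; lia.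
  apply: leq_trans (size_polyMleq _ _) _; rewrite /N.
  by move: (leq_add sD sA); move: (_ + size _)%N => x; lia.
apply: (@separable_nonsquare F (phi disc) A (phi V * B)) => //.
- by rewrite /phi deriv_map coprimep_map coprime_disc_deriv.
- rewrite size_map_poly ltnNge; apply/negP => sD.
  have : disc`_4 = 0 by rewrite nth_default // (leq_trans sD).
  by rewrite /disc coefD coefC coef_upolyX /= => /eqP; rewrite add0r oner_eq0.
- rewrite mulf_neq0 //.
    rewrite map_poly_eq0 !mulf_neq0 ?polyX_eq0 ?polyC_eq0 //.
    have : upoly^`()`_0 != 0 by rewrite deriv_upoly coefD coef1 coefCM coefX.
    by apply: contraNneq => ->; rewrite coef0.
  by apply: contra_eq_neq B0 => ->; rewrite coef0 eq_sym oner_eq0.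
Qed.

(** * Initial values, uniqueness and conclusion *)

Lemma is_sequence_cseq : is_sequence_c cseq.
Proof.
split; last exact: cseq_rec.
have h2 := half_bin2.
have h3 : half_bin 3 = - (1 / 8).
  have := half_binSS 0; rewrite half_bin1 => h.
  by apply: (@mulfI _ (4 * 2)); rewrite // h; field.
have h4 : half_bin 4 = 0.
  have := half_binSS 1; rewrite h2 mulr0 => h.
  by apply: (@mulfI _ (4 * 3)); rewrite // h mulr0.
rewrite /cseq; split.
- by rewrite big_geq.
- by rewrite big_nat1 /cterm half_bin1 subnn bin0; field.
- by rewrite big_ltn // big_ltn // big_geq // /cterm half_bin1 h2 binn /=; field.
- by rewrite big_ltn // big_ltn // big_ltn // big_geq //
     /cterm h2 h3 bin_small // bin0 /=; field.
- by rewrite big_ltn // big_ltn // big_ltn // big_ltn // big_geq //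
     /cterm h2 h3 h4 bin_small // bin1 /=; field.
Qed.

(** The leading coefficient [4 * (n + 4)] never vanishes, so the five initial values determine all
    others. *)
Lemma is_sequence_c_unique (c c' : nat -> rat) :
  is_sequence_c c -> is_sequence_c c' -> c' =1 c.
Proof.
move=> [[c0 c1 c2 c3 c4] rc] [[d0 d1 d2 d3 d4] rd]; elim/ltn_ind => n IH.
case: n IH => [|[|[|[|[|n]]]]] IH; rewrite ?(c0, c1, c2, c3, c4) //.
have IHk k : (k < 5)%N -> c' (n + k)%N = c (n + k)%N.
  by move=> k5; apply: IH; lia.
have := rd n; rewrite (IH n) ?(IHk 1) ?(IHk 2) ?(IHk 3) ?(IHk 4) //; last by lia.
rewrite (_ : n.+1.+4 = (n + 5)%N); last by lia.
have k0 : 4 * (n + 4)%:R != 0 :> rat by rewrite mulf_neq0 // pnatr_eq0 addnS.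
by have := rc n => h1 h2; apply: (mulfI k0); lra.
Qed.

Theorem theorem1p1 :
  exists c : nat -> rat,
    [/\ is_sequence_c c /\ (forall c' : nat -> rat, is_sequence_c c' -> c' =1 c),
        forall F : numFieldType,
          ~ has_constant_recurrence (fun n : nat => ratr (c n) : F),
        forall n : nat, exists m : nat, denq (c n) = (2 ^ m)%N%:Z
      & forall p : nat, prime p -> odd p ->
        forall k r : nat,
          congr_Zloc p (p ^ r.+1)%N (c (k * p ^ r.+1)%N) (c (k * p ^ r)%N)].
Proof.
exists cseq; split.
- split; first exact: is_sequence_cseq.
  by move=> c'; apply: is_sequence_c_unique; exact: is_sequence_cseq.
- exact: cseq_not_constant_recurrence.
- exact: denq_cseq.
- move=> p pp op k r; apply: congr_ZlocP => //; try exact/ZlocP/cseq_loc.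
  by rewrite expnS mulnCA; apply: cseq_gauss => //; rewrite dvdn_mull.
Qed.
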